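(* Let $U$ and $V$ be theories and let $K:U\to V$ and $M:V\to U$ be interpretations. Suppose that for every model $\mathcal M$ of $V$ we have $\widetilde M(\widetilde K(\mathcal M))=\mathcal M$ (equivalently, $K\circ M={\sf id}_V$ in ${\sf INT}_0$), and that for every model $\mathcal N$ of $U$ the model $\widetilde K(\widetilde M(\mathcal N))$ is elementarily equivalent to $\mathcal N$ (equivalently, $M\circ K={\sf id}_U$ in ${\sf INT}_3$). Then $U$ and $V$ are synonymous.
   Context: Theories are one-sorted first-order theories in a relational signature, with identity as a logical constant (no restriction on size of signature or complexity of the axiom set). An $m$-dimensional interpretation $K:U\to V$ is given by a $V$-formula $\delta_K(\vec x)$ with $\vec x$ of length $m$ and, for each $n$-ary predicate $P$ of $U$ (including identity), a $V$-formula $P_K(\vec x_0,\dots,\vec x_{n-1})$ with each $\vec x_i$ of length $m$; the translation $A^K$ of a $U$-formula commutes with the propositional connectives and relativizes quantifiers to $\delta_K$; it is required that $U\vdash A$ implies $V\vdash A^K$ for all $U$-sentences $A$. For $K:U\to V$ and $M:V\to W$, the composition $M\circ K:U\to W$ translates first by $K$ then by $M$ (domain $\delta_M(\vec x_0)\wedge\dots\wedge\delta_M(\vec x_{m-1})\wedge(\delta_K)^M$, and similarly for predicates); ${\sf id}_T$ is the identity interpretation of $T$ in itself. For a model $\mathcal M$ of $V$, $\widetilde K(\mathcal M)$ is the internal model of $U$ in $\mathcal M$ with domain $\{\vec m\mid\mathcal M\models\delta_K(\vec m)\}$ and each predicate $P$ (including identity) interpreted by $P_K$; thus $\widetilde{M\circ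 K}=\widetilde K\circ\widetilde M$. Two interpretations $K,K':U\to V$ are equal in ${\sf INT}_0$ if they have the same dimension and $V$ proves $\delta_K\leftrightarrow\delta_{K'}$ and, on $\delta_K$, $P_K\leftrightarrow P_{K'}$ for each predicate $P$ (including identity); they are equal in ${\sf INT}_3$ if $V\vdash A^K\leftrightarrow A^{K'}$ for every $U$-sentence $A$. $U$ and $V$ are synonymous (definitionally equivalent) iff there are interpretations $K:U\to V$, $M:V\to U$ with $M\circ K={\sf id}_U$ and $K\circ M={\sf id}_V$ in ${\sf INT}_0$.
   Formalization: The first ''equivalently'' is stated with the added clause that the product of the dimensions of K and M is 1 on the model side; this matters only for inconsistent V, where the model condition is vacuous but equality in INT_0 still requires equal dimension. The theorem itself has no such clause. *)

(* Defs.v *)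
From Stdlib Require List.
From mathcomp Require Import all_boot.
Set Implicit Arguments.
Unset Strict Implicit.
Unset Printing Implicit Defensive.

(** ** Syntax *)

Record signature := Signature { sym : Type; arity : sym -> nat }.

(** The predicates of a signature, including identity, which is [None]. *)
Definition predicate (S : signature) : Type := option (sym S).

Definition arityp (S : signature) (p : predicate S) : nat :=
  if p is Some P then arity P else 2.

(** [form S X]: formulas with free variables in the type [X].  The quantifier
    binds the variable [None] of [option X].  The remaining connectives and the
    existential quantifier are the usual classical abbreviations. *)
Inductive form (S : signature) (X : Type) : Type :=
| Atom (p : predicate S) (t : 'I_(arityp p) -> X)
| Bot
| Imp (A B : form S X)
| All (A : form S (option X)).

Arguments Bot {S X}.

Definition sentence (S : signature) : Type := form S void.

Definition Eq (S : signature) (X : Type) (x y : X) : form S X :=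
  @Atom S X None (fun i : 'I_2 => if i == ord0 then x else y).
Definition Not (S : signature) (X : Type) (A : form S X) := Imp A Bot.
Definition Top (S : signature) (X : Type) : form S X := Not Bot.
Definition And (S : signature) (X : Type) (A B : form S X) :=
  Not (Imp A (Not B)).
Definition Iff (S : signature) (X : Type) (A B : form S X) :=
  And (Imp A B) (Imp B A).

Arguments Top {S X}.
Arguments And {S X} A B.

Fixpoint ren (S : signature) (X Y : Type) (f : X -> Y) (A : form S X) :
    form S Y :=
  match A with
  | Atom p t => Atom (fun i => f (t i))
  | Bot => Bot
  | Imp A B => Imp (ren f A) (ren f B)
  | All A => All (ren (omap f) A)
  end.

Definition ord0_elim (X : Type) (i : 'I_0) : X :=
  match i with Ordinal _ lt_i0 => False_rect X (notF lt_i0) end.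

(** [alls A] universally quantifies the [m] variables [inr i] of [A]. *)
Fixpoint alls (S : signature) (m : nat) (X : Type) :
    form S (X + 'I_m)%type -> form S X :=
  match m with
  | 0 => ren (fun s => match s with inl x => x | inr i => ord0_elim X i end)
  | m'.+1 => fun A =>
      alls (All (ren (fun s => match s with
                               | inl x => Some (inl x)
                               | inr i => omap inr (unlift ord0 i)
                               end) A))
  end.

(** ** Provability *)

Record theory := Theory { tsig : signature; axiom : sentence tsig -> Prop }.

(** Classical natural deduction with identity; [map (ren Some)] makes [None]
    a fresh variable.  As [X] may be empty, the assumption of classical logic
    that the domain is not empty has its own rule [d_fresh]. *)
Inductive deriv (T : theory) :
    forall X : Type, seq (form (tsig T) X) -> form (tsig T) X -> Prop :=
| d_axiom X (G : seq (form (tsig T) X)) A :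
    axiom A -> deriv G (ren (of_void X) A)
| d_hyp X (G : seq (form (tsig T) X)) A : List.In A G -> deriv G A
| d_impI X (G : seq (form (tsig T) X)) A B : deriv (A :: G) B -> deriv G (Imp A B)
| d_impE X (G : seq (form (tsig T) X)) A B :
    deriv G (Imp A B) -> deriv G A -> deriv G B
| d_raa X (G : seq (form (tsig T) X)) A : deriv (Not A :: G) Bot -> deriv G A
| d_allI X (G : seq (form (tsig T) X)) A :
    deriv (map (ren Some) G) A -> deriv G (All A)
| d_allE X (G : seq (form (tsig T) X)) A (x : X) :
    deriv G (All A) -> deriv G (ren (odflt x) A)
| d_refl X (G : seq (form (tsig T) X)) (x : X) : deriv G (Eq _ x x)
| d_leibniz X (G : seq (form (tsig T) X)) A (x y : X) :
    deriv G (Eq _ x y) -> deriv G (ren (odflt x) A) -> deriv G (ren (odflt y) A)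
| d_fresh X (G : seq (form (tsig T) X)) A :
    deriv (map (ren Some) G) (ren Some A) -> deriv G A.

Definition proves (T : theory) (X : Type) (A : form (tsig T) X) : Prop :=
  @deriv T X [::] A.

(** ** Translations and interpretations *)

(** The variable [(i, j)] of [tpred p] is the [j]-th entry of the [i]-th
    argument. *)
Record translation (S S' : signature) := Translation {
  dim : nat;
  tdom : form S' 'I_dim;
  tpred : forall p : predicate S, form S' ('I_(arityp p) * 'I_dim)%type
}.

(** Each variable [x] becomes the block of variables [(x, j)], [j < dim K]. *)
Fixpoint trans (S S' : signature) (K : translation S S') (X : Type)
    (A : form S X) : form S' (X * 'I_(dim K))%type :=
  match A with
  | Atom p t => ren (fun ij => (t ij.1, ij.2)) (tpred K p)
  | Bot => Bot
  | Imp A B => Imp (trans K A) (trans K B)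
  | All A =>
      alls (Imp (ren inr (tdom K))
                (ren (fun xj => if xj.1 is Some x then inl (x, xj.2)
                                else inr xj.2)
                     (trans K A)))
  end.

(** [void * 'I_m] is empty, so the translation of a sentence is a sentence. *)
Definition strans (S S' : signature) (K : translation S S') (A : sentence S) :
  sentence S' := ren fst (trans K A).

Record interpretation (U V : theory) := Interpretation {
  itrans :> translation (tsig U) (tsig V);
  itransP : forall A : sentence (tsig U), proves A -> proves (strans itrans A)
}.

Definition idt (S : signature) : translation S S :=
  @Translation S S 1 Top (fun p => Atom (fun i => (i, ord0))).

Lemma flat_subproof (m k : nat) (i : 'I_m) (j : 'I_k) : i * k + j < m * k.
Proof.
apply: (@leq_trans (i.+1 * k)); last by rewrite leq_mul2r ltn_ord orbT.
by rewrite mulSn addnC ltn_add2r ltn_ord.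
Qed.

Definition flat (m k : nat) (i : 'I_m) (j : 'I_k) : 'I_(m * k) :=
  Ordinal (flat_subproof i j).

(** [tcomp M K] is M o K: first translate by [K], then by [M].  An [m]-tuple of
    [k]-tuples is flattened to an [m * k]-tuple. *)
Definition tcomp (S S' S'' : signature) (M : translation S' S'')
    (K : translation S S') : translation S S'' :=
  @Translation S S'' (dim K * dim M)
    (And (\big[And/Top]_(i < dim K) ren (flat i) (tdom M))
         (ren (fun ij => flat ij.1 ij.2) (trans M (tdom K))))
    (fun p =>
       And (\big[And/Top]_(a < arityp p) \big[And/Top]_(i < dim K)
              ren (fun j => (a, flat i j)) (tdom M))
           (ren (fun aij => (aij.1.1, flat aij.1.2 aij.2))
                (trans M (tpred K p)))).

Definition int0_eq (S : signature) (V : theory) (K K' : translation S (tsig V)) :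
    Prop :=
  exists e : dim K = dim K',
    proves (Iff (ren (cast_ord e) (tdom K)) (tdom K')) /\
    forall p : predicate S,
      proves
        (Imp (\big[And/Top]_(a < arityp p)
                ren (fun j => (a, cast_ord e j)) (tdom K))
             (Iff (ren (fun aj => (aj.1, cast_ord e aj.2)) (tpred K p))
                  (tpred K' p))).

Definition int3_eq (S : signature) (V : theory) (K K' : translation S (tsig V)) :
    Prop :=
  forall A : sentence S, proves (Iff (strans K A) (strans K' A)).

Definition synonymous (U V : theory) : Prop :=
  exists (K : interpretation U V) (M : interpretation V U),
    int0_eq (tcomp M K) (idt (tsig U)) /\ int0_eq (tcomp K M) (idt (tsig V)).

(** ** Structures and internal models *)

(** Identity is interpreted by a relation, since in an internal model it need
    not be the identity relation of the metatheory. *)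
Record structure (S : signature) := Structure {
  dom :> Type;
  interp : forall p : predicate S, ('I_(arityp p) -> dom) -> Prop
}.

Fixpoint sat (S : signature) (N : structure S) (X : Type) (A : form S X) :
    (X -> N) -> Prop :=
  match A with
  | Atom p t => fun v => interp (fun i => v (t i))
  | Bot => fun _ => False
  | Imp A B => fun v => sat A v -> sat B v
  | All A => fun v =>
      forall n : N, sat A (fun o => if o is Some x then v x else n)
  end.

Definition ssat (S : signature) (N : structure S) (A : sentence S) : Prop :=
  sat A (of_void N).

Definition is_model (T : theory) (N : structure (tsig T)) : Prop :=
  [/\ inhabited N,
      forall v : 'I_2 -> N, @interp _ N None v <-> v ord0 = v ord_max
    & forall A : sentence (tsig T), axiom A -> ssat N A].

Definition elem_equiv (S : signature) (N N' : structure S) : Prop :=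
  forall A : sentence S, ssat N A <-> ssat N' A.

(** The internal structure defined by [K] in [N]. *)
Definition internal (S S' : signature) (K : translation S S')
    (N : structure S') : structure S :=
  @Structure S {x : 'I_(dim K) -> N | sat (tdom K) x}
    (fun p v => sat (tpred K p) (fun ij => sval (v ij.1) ij.2)).

(** With both dimensions equal to 1: [y] is the element [n] of [N], up to the
    identification of an element with the 1-tuple having it as entry. *)
Definition is_elem (S S' : signature) (K : translation S S')
    (M : translation S' S) (N : structure S')
    (y : internal M (internal K N)) (n : N) : Prop :=
  forall i j, sval (sval y i) j = n.

(** The structure defined by [M] in the one defined by [K] in [N] is [N]
    itself: same domain, and same interpretation of all predicates, including
    identity. *)
Definition internal_internal_eq (S S' : signature) (K : translation S S')
    (M : translation S' S) (N : structure S') : Prop :=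
  [/\ dim M * dim K = 1,
      forall n : N, exists y : internal M (internal K N), is_elem y n
    & forall (p : predicate S')
        (v : 'I_(arityp p) -> internal M (internal K N))
        (w : 'I_(arityp p) -> N),
        (forall i, is_elem (v i) (w i)) -> (interp v <-> interp w)].

(* Main.v *)
Require Import Defs.
From Stdlib Require List.
From mathcomp Require Import all_boot boolp classical_sets.
(** By soundness and completeness both hypotheses may be read in models.  Write
    [F] for the map [N |-> internal K (internal M N)] on models of [U].  Since
    [internal M (internal K P)] is [P] for [P := internal M N], the structure
    [F N] is fixed by [F].  Being fixed by [F] is expressed by first-order
    sentences, and [N] is elementarily equivalent to [F N], so [N] itself is
    fixed by [F].  Hence [M o K] is the identity already in [INT_0].  If [V] has
    no model, then neither has [U], and any one-dimensional translations do. *)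

Set Implicit Arguments.
Unset Strict Implicit.
Unset Printing Implicit Defensive.

Lemma In_cat A (s t : seq A) x :
  List.In x (s ++ t) <-> List.In x s \/ List.In x t.
Proof. exact: List.in_app_iff. Qed.

Lemma In_map A B (f : A -> B) s y :
  List.In y (map f s) <-> exists x, f x = y /\ List.In x s.
Proof. exact: List.in_map_iff. Qed.

Lemma sval_inj A (P : A -> Prop) : injective (@proj1_sig A P).
Proof.
move=> [x Px] [y Py] /= xy; case: _ / xy Py => Py.
by rewrite (Prop_irrelevance Px Py).
Qed.

(** * Renaming and satisfaction *)

Section Renaming.
Variable S : signature.

Lemma ren_comp X Y Z (f : X -> Y) (g : Y -> Z) (A : form S X) :
  ren g (ren f A) = ren (fun x => g (f x)) A.
Proof.
elim: A Y Z f g => //= {}X.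
- by move=> A IHA B IHB Y Z f g; rewrite IHA IHB.
- move=> A IHA Y Z f g; rewrite IHA; congr (All (ren _ A)).
  by apply/funext; case.
Qed.

Fixpoint free (X : Type) (A : form S X) : X -> Prop :=
  match A with
  | Atom p t => fun x => exists i, t i = x
  | Bot => fun _ => False
  | Imp A B => fun x => free A x \/ free B x
  | All A => fun x => free A (Some x)
  end.

(** Only occurring variables matter, so a renaming that treats one variable specially acts plainly
    on the formulas where that variable is fresh. *)
Lemma eq_ren X Y (f g : X -> Y) (A : form S X) :
  (forall x, free A x -> f x = g x) -> ren f A = ren g A.
Proof.
elim: A Y f g => //= {}X.
- move=> p t Y f g fg; congr Atom; apply/funext => i.
  by apply: fg; exists i.
- move=> A IHA B IHB Y f g fg; congr Imp.
    by apply: IHA => x Ax; apply: fg; left.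
  by apply: IHB => x Bx; apply: fg; right.
- move=> A IHA Y f g fg; congr All; apply: IHA => -[x|] //= Ax.
  by rewrite fg.
Qed.

Lemma free_ren X Y (f : X -> Y) (A : form S X) y :
  free (ren f A) y -> exists2 x, free A x & f x = y.
Proof.
elim: A Y f y => //= {}X.
- by move=> p t Y f y [i <-]; exists (t i) => //; exists i.
- move=> A IHA B IHB Y f y [fA|fB].
    by have [x Ax <-] := IHA _ _ _ fA; exists x => //; left.
  by have [x Bx <-] := IHB _ _ _ fB; exists x => //; right.
- move=> A IHA Y f y fA; have [[x|] //= Ax [<-]] := IHA _ _ _ fA.
  by exists x.
Qed.

Lemma ren_id X (A : form S X) : ren id A = A.
Proof.
elim: A => //= {}X; first by move=> A -> B ->.
by move=> A {2}<-; congr (All (ren _ A)); apply/funext; case.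
Qed.

Lemma sat_ren (N : structure S) X Y (f : X -> Y) (A : form S X) (v : Y -> N) :
  sat (ren f A) v = sat A (fun x => v (f x)).
Proof.
elim: A Y f v => //= {}X; first by move=> A IHA B IHB Y f v; rewrite IHA IHB.
move=> A IHA Y f v; apply/propext; split=> sA n; move: (sA n);
  rewrite IHA; (have -> : (fun x : option X =>
    match omap f x with Some y => v y | None => n end) =
    (fun o => if o is Some x then v (f x) else n)) => //;
  by apply/funext; case.
Qed.

Lemma sat_imp (N : structure S) X (A B : form S X) (v : X -> N) :
  sat (Imp A B) v = (sat A v -> sat B v).
Proof. by []. Qed.

Lemma sat_and (N : structure S) X (A B : form S X) (v : X -> N) :
  sat (And A B) v <-> sat A v /\ sat B v.
Proof.
split=> [nAB|[sA sB] /(_ sA)]; last by apply.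
by split; apply: contrapT => nA; apply: nAB => sA // sB.
Qed.

Lemma sat_iff (N : structure S) X (A B : form S X) (v : X -> N) :
  sat (Iff A B) v <-> (sat A v <-> sat B v).
Proof. by rewrite /Iff sat_and; split=> -[]. Qed.

Lemma sat_big_and (N : structure S) X n (F : 'I_n -> form S X) (v : X -> N) :
  sat (\big[And/Top]_(i < n) F i) v <-> forall i, sat (F i) v.
Proof.
have big_and (r : seq 'I_n) :
    sat (\big[And/Top]_(i <- r) F i) v <-> forall i, i \in r -> sat (F i) v.
  elim: r => [|i r IHr]; first by rewrite big_nil; split=> [_ i|_ []].
  rewrite big_cons; split=> [/sat_and[sFi /IHr sFr] j|sF].
    by rewrite inE => /predU1P[->|/sFr].
  apply/sat_and; split; first by apply: sF; rewrite mem_head.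
  by apply/IHr => j rj; apply: sF; rewrite inE rj orbT.
rewrite big_and; split=> [sF i|sF i _]; last exact: sF.
by apply: sF; rewrite mem_index_enum.
Qed.

Lemma sat_alls (N : structure S) m X (A : form S (X + 'I_m)%type) (v : X -> N) :
  sat (alls A) v <->
  forall n : 'I_m -> N, sat A (fun s => match s with inl x => v x | inr i => n i end).
Proof.
elim: m X A v => [|m IHm] X A v /=.
  rewrite sat_ren; split=> [sA n|/(_ (@ord0_elim _))].
    apply: (eq_ind _ (sat A) sA); apply/funext.
    by case=> // -[].
  by congr (sat A _); apply/funext; case=> // -[].
rewrite IHm /=; split=> [sA n|sA n a].
  have:= sA (fun i => n (lift ord0 i)) (n ord0); rewrite sat_ren.
  congr (sat A _); apply/funext; case=> //= i.
  by case: unliftP => [j ->|->].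
rewrite sat_ren.
have:= sA (fun i => if unlift ord0 i is Some j then n j else a).
congr (sat A _); apply/funext; case=> //= i.
by case: (unlift ord0 i).
Qed.

End Renaming.

(** The relation is total on both sides but need not be functional: identity is just one of the
    preserved predicates, so a structure may be matched with its quotient by that predicate. *)
Definition iso (S : signature) (N1 N2 : structure S) (R : N1 -> N2 -> Prop) :=
  [/\ forall a, exists b, R a b, forall b, exists a, R a b &
      forall p (v : 'I_(arityp p) -> N1) w,
        (forall i, R (v i) (w i)) -> (interp v <-> interp w)].

Lemma iso_sat (S : signature) (N1 N2 : structure S) (R : N1 -> N2 -> Prop)
    X (A : form S X) (v : X -> N1) (w : X -> N2) :
  iso R -> (forall x, R (v x) (w x)) -> (sat A v <-> sat A w).
Proof.
move=> [Rl Rr Rp]; elim: A v w => /= {}X //.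
- by move=> p t v w vw; apply: Rp.
- by move=> A IHA B IHB v w vw; rewrite (IHA _ _ vw) (IHB _ _ vw).
- move=> A IHA v w vw; split=> sA.
    move=> b; have [a Rab] := Rr b; apply: iffLR (sA a); apply: IHA.
    by case.
  move=> a; have [b Rab] := Rl a; apply: iffRL (sA b); apply: IHA.
  by case.
Qed.

Lemma iso_elem_equiv (S : signature) (N1 N2 : structure S)
    (R : N1 -> N2 -> Prop) :
  iso R -> elem_equiv N1 N2.
Proof. by move=> isoR A; apply: (iso_sat A isoR); case. Qed.

(** * Completeness *)

Section Derivations.
Variable T : theory.
Local Notation S := (tsig T).

Lemma deriv_weaken X (G G' : seq (form S X)) A :
  (forall B, List.In B G -> List.In B G') -> deriv G A -> deriv G' A.
Proof.
move=> GG' dA; elim: dA G' GG' => {G A} {}X G.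
- by move=> A ? G' _; apply: d_axiom.
- by move=> A GA G' GG'; apply: d_hyp; apply: GG'.
- move=> A B _ IH G' GG'; apply: d_impI; apply: IH => C /= [->|/GG']; first by left.
  by right.
- by move=> A B _ IH1 _ IH2 G' GG'; apply: d_impE (IH1 _ GG') (IH2 _ GG').
- move=> A _ IH G' GG'; apply: d_raa; apply: IH => C /= [->|/GG']; first by left.
  by right.
- move=> A _ IH G' GG'; apply: d_allI; apply: IH => C.
  move=> /In_map[B [<- /GG' GB]].
  exact: (List.in_map (ren Some)).
- by move=> A x _ IH G' GG'; apply: d_allE; apply: IH.
- by move=> x G' _; apply: d_refl.
- by move=> A x y _ IH1 _ IH2 G' GG'; apply: d_leibniz (IH1 _ GG') (IH2 _ GG').
- move=> A _ IH G' GG'; apply: d_fresh; apply: IH => C.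
  move=> /In_map[B [<- /GG' GB]].
  exact: (List.in_map (ren Some)).
Qed.

Lemma map_ren_comp X Y Z (f : X -> Y) (g : Y -> Z) (G : seq (form S X)) :
  map (ren g) (map (ren f) G) = map (ren (fun x => g (f x))) G.
Proof. by rewrite -map_comp; apply: eq_map => A /=; rewrite ren_comp. Qed.

Lemma ren_odflt X Y (f : X -> Y) x (A : form S (option X)) :
  ren f (ren (odflt x) A) = ren (odflt (f x)) (ren (omap f) A).
Proof. by rewrite !ren_comp; congr (ren _ A); apply/funext; case. Qed.

Lemma ren_Eq X Y (f : X -> Y) x y : ren f (Eq S x y) = Eq S (f x) (f y).
Proof. by congr Atom; apply/funext => i /=; case: ifP. Qed.

Lemma deriv_ren X Y (f : X -> Y) (G : seq (form S X)) A :
  deriv G A -> deriv (map (ren f) G) (ren f A).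
Proof.
move=> dA; elim: dA Y f => {G A} {}X G.
- move=> A axA Y f; rewrite ren_comp.
  have -> : (fun x : void => f (of_void X x)) = of_void Y by apply/funext; case.
  exact: d_axiom.
- by move=> A GA Y f; apply: d_hyp; apply: (List.in_map (ren f)).
- by move=> A B _ IH Y f; apply: d_impI; apply: IH.
- by move=> A B _ IH1 _ IH2 Y f; apply: d_impE (IH1 _ f) (IH2 _ f).
- by move=> A _ IH Y f; apply: d_raa; apply: IH.
- move=> A _ IH Y f; apply: d_allI; have:= IH _ (omap f).
  by rewrite !map_ren_comp.
- by move=> A x _ IH Y f; rewrite ren_odflt; apply: d_allE; apply: IH.
- by move=> x Y f; rewrite ren_Eq; apply: d_refl.
- move=> A x y _ IH1 _ IH2 Y f; rewrite ren_odflt; apply: (d_leibniz (x := f x)).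
    by rewrite -ren_Eq; apply: IH1.
  by rewrite -ren_odflt; apply: IH2.
- move=> A _ IH Y f; apply: d_fresh; have:= IH _ (omap f).
  by rewrite !map_ren_comp !ren_comp.
Qed.

Lemma deriv_cut X (G : seq (form S X)) A B :
  deriv G A -> deriv (A :: G) B -> deriv G B.
Proof. by move=> dA dB; apply: d_impE dA; apply: d_impI. Qed.

Lemma deriv_bot X (G : seq (form S X)) A : deriv G Bot -> deriv G A.
Proof.
by move=> dB; apply: d_raa; apply: deriv_weaken dB => C; right.
Qed.

Theorem soundness X (A : form S X) (N : structure S) (v : X -> N) :
  is_model N -> proves A -> sat A v.
Proof.
move=> [[n0] eqN axN]; rewrite /proves => dA.
have: forall B, List.In B [::] -> sat B v by [].
elim: dA v => {A} {}X G.
- move=> A /axN sA v _; rewrite sat_ren.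
  by congr (sat A _): sA; apply/funext; case.
- by move=> A GA v; apply.
- move=> A B _ IH v sG sA; apply: IH => C /= [<-//|]; exact: sG.
- by move=> A B _ IH1 _ IH2 v sG; apply: (IH1 v sG); apply: IH2.
- move=> A _ IH v sG; apply: contrapT => nA; apply: (IH v) => C /= [<-//|].
  exact: sG.
- move=> A _ IH v sG n; apply: IH => C /In_map[B [<- GB]].
  by rewrite sat_ren; apply: sG.
- move=> A x _ IH v sG; rewrite sat_ren; move: (IH v sG (v x)).
  by congr (sat A _); apply/funext; case.
- by move=> x v _; apply/eqN.
- move=> A x y _ /[swap] _ /[swap] IH2 IH1 v sG.
  have /eqN /= exy := IH1 v sG; move: (IH2 v sG); rewrite !sat_ren.
  by congr (sat A _); apply/funext; case.
(* Nonemptiness of the domain supplies the value [n0] of the fresh variable. *)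
- move=> A _ IH v sG.
  have := IH (fun o => if o is Some x then v x else n0).
  rewrite sat_ren; apply => C /In_map[B [<- GB]].
  by rewrite sat_ren; apply: sG.
Qed.

End Derivations.

(** * Coding formulas as fresh variables *)

(** Trees code formulas whose free variables are themselves trees, wrapped in
    [TFree]; the code of a formula is then a variable fresh for that formula. *)
Inductive tree (S : signature) (X : Type) : Type :=
| TLeaf (x : X)
| TBound (k : nat)
| TFree (w : tree S X)
| TAtom (p : predicate S) (t : 'I_(arityp p) -> tree S X)
| TBot
| TImp (a b : tree S X)
| TAll (a : tree S X).

Arguments TLeaf S {X} x.
Arguments TBound {S X} k.
Arguments TBot {S X}.

Section Coding.
Variables (S : signature) (X : Type).
Local Notation W := (tree S X).

(** An environment that starts as [TFree] returns only wrapped free variables and de Bruijn indices,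
    so passing a binder affects the root alone. *)
Definition shift (w : W) : W := if w is TBound k then TBound k.+1 else w.

Fixpoint code (Y : Type) (A : form S Y) : (Y -> W) -> W :=
  match A with
  | Atom p t => fun e => TAtom (fun i => e (t i))
  | Bot => fun _ => TBot
  | Imp A B => fun e => TImp (code A e) (code B e)
  | All A => fun e =>
      TAll (code A (fun o => if o is Some y then shift (e y) else TBound 0))
  end.

Lemma shift_inj : injective shift.
Proof. by case=> [?|?|?|? ?||? ?|?] [?|?|?|? ?||? ?|?] //= [->]. Qed.

Lemma TAtom_inj (p : predicate S) (t u : 'I_(arityp p) -> W) :
  TAtom t = TAtom u -> t = u.
Proof.
(* The type of the arguments depends on the predicate: [P] transports them along an equality of
   predicates, which proof irrelevance turns into [erefl]. *)
pose P (w : W) := if w is TAtom q s then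
  exists e : q = p, eq_rect q (fun q => 'I_(arityp q) -> W) s p e = u else True.
move=> tu; have: P (TAtom u) by exists erefl.
by rewrite -tu => -[e]; rewrite (Prop_irrelevance e erefl).
Qed.

Lemma code_inj (Y : Type) (A B : form S Y) (e : Y -> W) :
  injective e -> code A e = code B e -> A = B.
Proof.
elim: A B e => {}Y.
- move=> p t [q u| | |] //= e e_inj E.
  have pq : p = q by case: E.
  case: _ / pq u E => u /TAtom_inj E; congr Atom; apply/funext => i.
  by apply: e_inj; rewrite (congr1 (fun f => f i) E).
- by case.
- move=> A IHA B IHB [| |A' B'|] //= e e_inj [EA EB].
  by rewrite (IHA _ _ e_inj EA) (IHB _ _ e_inj EB).
- move=> A IHA [| | |A'] //= e e_inj [/IHA-> //].
  (* The extended environment stays injective because [shift] never yields [TBound 0]. *)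
  move=> [y|] [z|] //=; first by move=> /shift_inj /e_inj->.
    by case: (e y).
  by case: (e z).
Qed.

(** As [TFree] adds one, the code of a formula under the environment [TFree] is strictly higher than
    each of its free variables. *)
Fixpoint height (w : W) : nat :=
  match w with
  | TLeaf _ | TBound _ | TBot => 0
  | TFree w | TAll w => (height w).+1
  | TAtom p t => foldr (fun i => maxn (height (t i))) 0 (enum 'I_(arityp p))
  | TImp a b => maxn (height a) (height b)
  end.

Lemma height_shift w : height (shift w) = height w.
Proof. by case: w. Qed.

Lemma height_code (Y : Type) (A : form S Y) (e : Y -> W) y :
  free A y -> height (e y) <= height (code A e).
Proof.
elim: A e y => {}Y //=.
- move=> p t e y [i <-]; have: i \in enum 'I_(arityp p) by rewrite mem_enum.
  elim: (enum _) => //= j s IHs; rewrite inE leq_max => /predU1P[->|/IHs->].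
    by rewrite leqnn.
  by rewrite orbT.
- move=> A IHA B IHB e y [/IHA|/IHB] /(_ e) H; rewrite leq_max H //.
  by rewrite orbT.
- move=> A IHA e y /IHA - /(_ (fun o => if o is Some y then shift (e y)
    else TBound 0)) /=.
  by rewrite height_shift; apply: leqW.
Qed.

End Coding.

(** * Henkin axioms and their conservativity *)

Section Henkin.
Variables (T : theory) (X : Type).
Local Notation S := (tsig T).
Local Notation W := (tree S X).

Definition witness (B : form S (option W)) : W := code (All B) (@TFree S X).

(** A Henkin axiom in universal form: the witness is a counterexample to [B] if there is any. *)
Definition henkin (B : form S (option W)) : form S W :=
  Imp (ren (odflt (witness B)) B) (All B).

Lemma witness_inj : injective witness.
Proof. by move=> B C E; have [] : All B = All C by apply: code_inj E => ? ? []. Qed.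

Lemma witness_fresh (B : form S (option W)) w :
  free B (Some w) -> height w < height (witness B).
Proof. exact: (@height_code S X W (All B) (@TFree S X) w). Qed.

(* A witness that occurs nowhere else can be generalized, and
   [exists x, (B x -> forall y, B y)] is a tautology. *)
Lemma henkin_elim (B : form S (option W)) (D : seq (form S W)) :
  (forall C, List.In C D -> ~ free C (witness B)) ->
  deriv (henkin B :: D) Bot -> deriv D Bot.
Proof.
move=> freshD; set c := witness B in freshD *.
(* Turn the witness into the bound variable [None] and keep all others; freshness leaves [B] and [D]
   otherwise unchanged. *)
pose f w := if `[< w = c >] then None else Some w.
have fc : f c = None by rewrite /f asboolT.
have fS w : w <> c -> f w = Some w by move=> wc; rewrite /f asboolF.
have free_c w : free B (Some w) -> w <> c.
  by move=> /witness_fresh /[swap] ->; rewrite ltnn.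
move=> /(deriv_ren f).
have -> : map (ren f) (henkin B :: D) =
    Imp B (ren Some (All B)) :: map (ren Some) D.
  rewrite /henkin -/c /=; congr (Imp _ (All _) :: _).
  - rewrite ren_comp -[RHS]ren_id; apply: eq_ren => -[w|] //= Bw.
    exact/fS/free_c.
  - by apply: eq_ren => -[w|] //= Bw; rewrite fS //; apply: free_c.
  - apply: (List.map_ext_in (ren f)) => C DC; apply: eq_ren => w Cw.
    by apply: fS => wc; apply: (freshD _ DC); rewrite -wc.
(* Under [Not B] the renamed axiom holds vacuously and [dB] gives a contradiction; hence [B] for a
   generic variable. *)
move=> dB; have dAll : deriv D (All B).
  apply: d_allI; apply: d_raa; apply: (@deriv_cut _ _ _ (Imp B (ren Some (All B)))).
    apply: d_impI; apply: deriv_bot; apply: (@d_impE _ _ _ B).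
      by apply: d_hyp; right; left.
    by apply: d_hyp; left.
  by apply: deriv_weaken dB => C /= [->|?]; [left | right; right].
(* Now the conclusion of the renamed axiom is derivable, so the axiom is too, and [dB] refutes [D]
   once more. *)
apply: d_fresh; apply: deriv_cut dB; apply: d_impI.
by apply: deriv_weaken (deriv_ren Some dAll) => C; right.
Qed.

Lemma exists_max_height (h : form S (option W)) hs :
  exists2 B, List.In B (h :: hs) &
    forall C, List.In C (h :: hs) -> height (witness C) <= height (witness B).
Proof.
elim: hs h => [|h' hs IHhs] h; first by exists h; [left | move=> C [<-|[]]].
have [B hsB maxB] := IHhs h'.
have [le|/ltnW le] := leqP (height (witness h)) (height (witness B)).
  by exists B; [right | move=> C [<-|/maxB]].
exists h; first by left.
by move=> C [<-|/maxB /leq_trans -> //].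
Qed.

(* A witness of maximal height occurs in no other Henkin axiom. *)
Lemma henkin_conservative (hs : seq (form S (option W))) (D : seq (form S W)) :
  (forall C w, List.In C D -> free C w -> exists x, w = TLeaf S x) ->
  deriv (map henkin hs ++ D) Bot -> deriv D Bot.
Proof.
move=> leafD; have [n] := ubnP (size hs).
elim: n hs => // n IHn [|h hs] // ltn d.
have [B hsB maxB] := exists_max_height h hs.
have dec (x y : form S (option W)) : {x = y} + {x <> y} by apply: pselect.
apply: (IHn (List.remove dec B (h :: hs))).
  rewrite -ltnS; apply: leq_trans ltn; rewrite ltnS; apply/ltP.
  exact: (List.remove_length_lt dec _ _ hsB).
apply: (@henkin_elim B) => [C /In_cat[|DC]|].
(* A variable of [A] lies below [witness A], hence below [witness B]; and [witness A] differs from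
   [witness B] by injectivity. *)
- move=> /In_map[A [<- rA]] /=.
  have [hsA AB] := List.in_remove dec _ _ _ rA.
  have freeA w : free A (Some w) -> w <> witness B.
    by move=> /witness_fresh /leq_trans/(_ (maxB _ hsA)) /[swap] ->; rewrite ltnn.
  case=> [fA|/freeA//]; have [[w|] /= Aw] := free_ren fA; first exact: freeA.
  by move=> /witness_inj.
- by move=> /(leafD _ _ DC)[x].
apply: deriv_weaken d => C /In_cat[|DC]; last first.
  by right; apply/In_cat; right.
move=> /In_map[A [<- hsA]].
case: (dec A B) => [->|AB]; first by left.
right; apply/In_cat; left; apply: (List.in_map henkin).
exact: List.in_in_remove.
Qed.

End Henkin.

(** * Maximal consistent sets and their canonical models *)

Section MaximalConsistent.
Variables (T : theory) (X : Type).
Local Notation S := (tsig T).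
Implicit Types (Phi Psi : form S X -> Prop) (G : seq (form S X)).

Definition consistent Phi :=
  forall G, (forall B, List.In B G -> Phi B) -> ~ deriv G Bot.

Definition maximal_consistent Phi :=
  consistent Phi /\
  forall Psi, consistent Psi -> (forall B, Phi B -> Psi B) ->
    forall B, Psi B -> Phi B.

Lemma lindenbaum Phi :
  consistent Phi ->
  exists2 Psi, maximal_consistent Psi & forall B, Phi B -> Psi B.
Proof.
move=> consPhi.
pose I := {Psi | consistent Psi /\ forall B, Phi B -> Psi B}.
pose R (P Q : I) : bool := `[< forall B, sval P B -> sval Q B >].
have Rrefl P : R P P by apply/asboolP.
have Rtrans P Q O : R P Q -> R Q O -> R P O.
  by move=> /asboolP PQ /asboolP QO; apply/asboolP => B /PQ/QO.
have Ranti P Q : R P Q -> R Q P -> P = Q.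
  move=> /asboolP PQ /asboolP QP; apply: sval_inj.
  by apply/funext => B; apply/propext; split; [apply: PQ | apply: QP].
have [|Psi maxPsi] := Zorn Rrefl Rtrans Ranti.
  move=> A chainA.
  have [A0|] := pselect (exists P, A P); last first.
    (* The empty chain is bounded by [Phi] itself; its union would not contain [Phi]. *)
    move=> A0; exists (exist _ Phi (conj consPhi (fun _ => id))) => P AP.
    by case: A0; exists P.
  have [P0 AP0] := A0.
  pose U B := exists2 P, A P & sval P B.
  have consU : consistent U.
    (* A derivation uses finitely many hypotheses, and in a chain these all lie in a single
       member. *)
    move=> G GU; have [P AP GP] : exists2 P, A P & forall B, List.In B G -> sval P B.
      elim: G GU => [|C G IHG] GU; first by exists P0.
      have [P AP GP] := IHG (fun B GB => GU B (or_intror GB)).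
      have [Q AQ QC] := GU C (or_introl erefl).
      have [/asboolP PQ|/asboolP QP] := chainA P Q AP AQ.
        by exists Q => // B /= [<-//|/GP/PQ].
      by exists P => // B /= [<-|/GP//]; apply: QP.
    exact: (proj1 (svalP P)).
  have PhiU B : Phi B -> U B by move=> PhiB; exists P0 => //; apply: (proj2 (svalP P0)).
  exists (exist _ U (conj consU PhiU)) => P AP; apply/asboolP => B PB.
  by exists P.
have [consPsi PhiPsi] := svalP Psi.
exists (sval Psi) => //; split=> // Psi' consPsi' PsiPsi' B Psi'B.
have PhiPsi' C : Phi C -> Psi' C by move=> /PhiPsi/PsiPsi'.
pose P' : I := exist _ Psi' (conj consPsi' PhiPsi').
by rewrite -(maxPsi P' (asboolT PsiPsi')).
Qed.

Variable Phi : form S X -> Prop.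
Hypothesis mPhi : maximal_consistent Phi.

(** Otherwise adding [B] to [Phi] would keep it consistent, and maximality would put [B] into
    [Phi]. *)
Lemma mc_not B : ~ Phi B ->
  exists2 G, (forall C, List.In C G -> Phi C) & deriv (B :: G) Bot.
Proof.
move=> nB; apply: contrapT => nG; apply: nB.
apply: (proj2 mPhi (fun C => C = B \/ Phi C)) => [G GB dG| |]; [|by right|by left].
apply: nG.
have [G' PhiG' GG'] : exists2 G', (forall C, List.In C G' -> Phi C) &
    forall C, List.In C G -> C = B \/ List.In C G'.
  elim: G GB {dG} => [|C G IHG] GB; first by exists [::].
  have [G' PhiG' GG'] := IHG (fun D GD => GB D (or_intror GD)).
  have [->|PhiC] := GB C (or_introl erefl).
    by exists G' => // D /= [<-|/GG']; [left|].
  exists (C :: G') => [D /= [<-|/PhiG']|D /= [<-|/GG'[]]] //.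
  - by right; left.
  - by left.
  - by right; right.
exists G' => //; apply: deriv_weaken dG => C /GG'[->|?]; first by left.
by right.
Qed.

Lemma mc_deriv G B : (forall C, List.In C G -> Phi C) -> deriv G B -> Phi B.
Proof.
move=> PhiG dB; apply: contrapT => /mc_not[G' PhiG' dG'].
apply: (proj1 mPhi (G ++ G')) => [C /In_cat[/PhiG|/PhiG']//|].
apply: (@deriv_cut _ _ _ B).
  by apply: deriv_weaken dB => C GC; apply/In_cat; left.
apply: deriv_weaken dG' => C /= [->|G'C]; first by left.
by right; apply/In_cat; right.
Qed.

Lemma mc_bot : ~ Phi Bot.
Proof.
move=> PhiB; apply: (proj1 mPhi [:: Bot]) => [C [<-|[]] //|].
by apply: d_hyp; left.
Qed.

Lemma mc_imp A B : Phi (Imp A B) <-> (Phi A -> Phi B).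
Proof.
split=> [PhiAB PhiA|PhiAB].
  apply: (@mc_deriv [:: Imp A B; A]) => [C [<-|[<-|[]]] //|].
  apply: (@d_impE _ _ _ A); apply: d_hyp; first by left.
  by right; left.
have [/PhiAB PhiB|/mc_not[G PhiG dA]] := pselect (Phi A).
  apply: (@mc_deriv [:: B]) => [C [<-|[]] //|].
  by apply: d_impI; apply: d_hyp; right; left.
by apply: (@mc_deriv G) => //; apply: d_impI; apply: deriv_bot.
Qed.

Lemma mc_refl x : Phi (Eq S x x).
Proof. by apply: (@mc_deriv [::]) => //; apply: d_refl. Qed.

Lemma mc_leibniz (A : form S (option X)) x y :
  Phi (Eq S x y) -> Phi (ren (odflt x) A) -> Phi (ren (odflt y) A).
Proof.
move=> Exy Ax; apply: (@mc_deriv [:: Eq S x y; ren (odflt x) A]).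
  by move=> C [<-|[<-|[]]].
apply: (d_leibniz (x := x)); apply: d_hyp; first by left.
by right; left.
Qed.

Lemma mc_sym x y : Phi (Eq S x y) -> Phi (Eq S y x).
Proof.
move=> Exy; have := @mc_leibniz (Eq S None (Some x)) x y Exy.
by rewrite !ren_Eq; apply; apply: mc_refl.
Qed.

Lemma mc_trans x y z : Phi (Eq S x y) -> Phi (Eq S y z) -> Phi (Eq S x z).
Proof.
move=> Exy Eyz; have := @mc_leibniz (Eq S (Some x) None) y z Eyz.
by rewrite !ren_Eq; apply.
Qed.

Lemma mc_atom p (t u : 'I_(arityp p) -> X) :
  (forall i, Phi (Eq S (t i) (u i))) -> Phi (Atom t) -> Phi (Atom u).
Proof.
(* Arguments are exchanged one at a time: [mix k] takes the first [k] from [u] and the rest from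
   [t], and each step is one use of Leibniz's law at position [k]. *)
move=> tu Pt; pose mix k (i : 'I_(arityp p)) := if i < k then u i else t i.
have Pmix k : k <= arityp p -> Phi (Atom (mix k)).
  elim: k => [_|k IHk ltk]; first by congr (Phi (Atom _)): Pt; apply/funext.
  pose j := Ordinal ltk.
  pose A := @Atom S (option X) p (fun i => if i == j then None else Some (mix k i)).
  have := @mc_leibniz A (t j) (u j) (tu j); rewrite /A /=.
  have -> : (fun i => odflt (t j) (if i == j then None else Some (mix k i))) = mix k.
    apply/funext => i; case: eqP => //= ->.
    by rewrite /mix /= ltnn.
  have -> : (fun i => odflt (u j) (if i == j then None else Some (mix k i))) = mix k.+1.
    apply/funext => i; case: eqP => [->|ij] /=; first by rewrite /mix /= ltnSn.
    rewrite /mix ltnS [i <= k]leq_eqVlt; case: eqP => //= ik.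
    by case: ij; apply: val_inj.
  by apply; apply: IHk; apply: ltnW.
have := Pmix _ (leqnn _); congr (Phi (Atom _)).
by apply/funext => i; rewrite /mix ltn_ord.
Qed.

Hypothesis henkinPhi : forall B : form S (option X),
  exists c, Phi (ren (odflt c) B) -> Phi (All B).

Definition term_structure : structure S :=
  @Structure S X (fun p v => Phi (@Atom S X p v)).

(** The truth lemma. Only the quantifier case uses [henkinPhi]: truth at the witness already puts
    the universal formula into [Phi]. *)
Lemma sat_term Y (A : form S Y) (v : Y -> term_structure) :
  sat A v <-> Phi (ren v A).
Proof.
elim: A v => {}Y //=.
- by move=> v; split=> // /mc_bot.
- by move=> A IHA B IHB v; rewrite mc_imp IHA IHB.
move=> A IHA v.
have E n : ren (fun o => if o is Some x then v x else n) A =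
    ren (odflt n) (ren (omap v) A).
  by rewrite ren_comp; congr (ren _ A); apply/funext; case.
split=> [sA|PhiA n].
  by have [c] := henkinPhi (ren (omap v) A); apply; rewrite -E -IHA.
rewrite IHA E; apply: (@mc_deriv [:: All (ren (omap v) A)]).
  by move=> C [<-|[]].
by apply: d_allE; apply: d_hyp; left.
Qed.

Lemma Eq_class_ex x : exists y, Phi (Eq S x y).
Proof. by exists x; apply: mc_refl. Qed.

Definition canon x : X := sval (cid (Eq_class_ex x)).

Lemma canonP x : Phi (Eq S x (canon x)).
Proof. exact: (svalP (cid (Eq_class_ex x))). Qed.

Lemma eq_canon x y : Phi (Eq S x y) -> canon x = canon y.
Proof.
move=> Exy; rewrite /canon.
move: (Eq_class_ex x) (Eq_class_ex y).
(* Equivalent variables have extensionally equal classes, and [cid] chooses the same element from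
   equal predicates. *)
have -> : (fun z => Phi (Eq S x z)) = (fun z => Phi (Eq S y z)).
  apply/funext => z; apply/propext; split; first exact/mc_trans/mc_sym.
  exact: mc_trans.
by move=> e e'; rewrite (Prop_irrelevance e e').
Qed.

(** The quotient of [term_structure] by identity, realized on chosen representatives so that
    identity becomes true equality. *)
Definition canon_structure : structure S :=
  @Structure S {x | canon x = x} (fun p v => Phi (@Atom S X p (fun i => sval (v i)))).

Definition canon_of x : canon_structure :=
  exist _ (canon x) (esym (eq_canon (canonP x))).

Lemma canon_iso :
  iso (fun (x : term_structure) (n : canon_structure) => Phi (Eq S x (sval n))).
Proof.
split=> [x|n|p v w vw].
- by exists (canon_of x); apply: canonP.
- by exists (sval n); apply: mc_refl.
- by split; apply: mc_atom => // i; apply/mc_sym.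
Qed.

Lemma canon_model (x0 : X) : @is_model T canon_structure.
Proof.
split=> [|v|A axA].
- exact: (inhabits (canon_of x0)).
- rewrite /=; have -> : @Atom S X None (fun i => sval (v i)) =
      Eq S (sval (v ord0)) (sval (v ord_max)).
    congr Atom; apply/funext => i.
    by case: ifPn => [/eqP->|] //; case: i => -[|[]] // lt _; congr (sval (v _)); apply: val_inj.
  split=> [/eq_canon|->]; last exact: mc_refl.
  rewrite (svalP (v ord0)) (svalP (v ord_max)) => E; exact: sval_inj.
- rewrite /ssat -(iso_sat (v := of_void term_structure) A canon_iso); last by case.
  by rewrite sat_term; apply: (@mc_deriv [::]) => //; apply: d_axiom.
Qed.

Lemma canon_sat Y (A : form S Y) (v : Y -> X) :
  sat A (fun y => canon_of (v y)) <-> Phi (ren v A).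
Proof.
by rewrite -sat_term; apply: iff_sym; apply: (iso_sat A canon_iso) => y; apply: canonP.
Qed.

End MaximalConsistent.

(** Henkin's argument: if [A] is unprovable, its negation together with all Henkin axioms is
    consistent, and the canonical model of a maximal extension refutes [A]. *)
Theorem completeness (T : theory) X (A : form (tsig T) X) :
  (forall (N : structure (tsig T)) (v : X -> N), is_model N -> sat A v) ->
  proves A.
Proof.
move=> validA; apply: contrapT => nA.
pose A0 := Not (ren (TLeaf (tsig T)) A).
have consA : consistent (fun B => B = A0 \/ exists C, B = @henkin T X C).
  move=> G PhiG dG; apply: nA.
  have [hs Ghs] : exists hs, forall B, List.In B G ->
      List.In B (map (@henkin T X) hs ++ [:: A0]).
    elim: G PhiG {dG} => [|B G IHG] PhiG; first by exists [::].
    have [hs Ghs] := IHG (fun D GD => PhiG D (or_intror GD)).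
    have [->|[C ->]] := PhiG B (or_introl erefl).
      exists hs => D /= [<-|/Ghs//]; apply/In_cat.
      by right; left.
    exists (C :: hs) => D /= [<-|/Ghs ?]; first by left.
    by right.
  have dA0 : deriv [:: A0] Bot.
    apply: (@henkin_conservative _ _ hs) => [C w [<-|[]] //=|].
      by case=> // fA; have [x _ <-] := free_ren fA; exists x.
    exact: deriv_weaken dG.
  have dA : deriv [::] (ren (TLeaf (tsig T)) A) by apply: d_raa.
  (* Return from trees to [X]: leaves go back to their labels, and all other trees collapse to one
     fresh variable. *)
  apply: d_fresh.
  have := deriv_ren (fun w => if w is TLeaf x then Some x else None) dA.
  by rewrite ren_comp.
have [Phi mPhi A0Phi] := lindenbaum consA.
have henkinPhi B : exists c, Phi (ren (odflt c) B) -> Phi (All B).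
  exists (witness B); apply: (iffLR (mc_imp mPhi _ _)).
  by apply: A0Phi; right; exists B.
have PhiA0 : Phi A0 by apply: A0Phi; left.
apply: (mc_bot mPhi); apply: (iffLR (mc_imp mPhi _ _) PhiA0).
apply: (iffLR (canon_sat mPhi henkinPhi _ _)).
(* [TBot] shows that the model is inhabited even when [X] is empty. *)
apply: validA; exact: (canon_model mPhi henkinPhi TBot).
Qed.

(** * Internal models *)

Section Internal.
Variables S S' : signature.
Implicit Types (K : translation S S') (N : structure S').

Lemma sat_trans K N X (A : form S X) (u : X -> internal K N) :
  sat (trans K A) (fun xj => sval (u xj.1) xj.2) <-> sat A u.
Proof.
elim: A u => {}X //=.
- by move=> p t u; rewrite sat_ren.
- by move=> A IHA B IHB u; rewrite IHA IHB.
move=> A IHA u; rewrite sat_alls /=; split=> [sA a|sA n].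
  move: (sA (sval a)); rewrite !sat_ren => /(_ (svalP a)) sa; rewrite -IHA.
  by congr (sat _ _): sa; apply/funext => -[[x|] j].
rewrite !sat_ren => sn; have := sA (exist _ n sn); rewrite -IHA.
by congr (sat _ _); apply/funext => -[[x|] j].
Qed.

Lemma ssat_strans K N (A : sentence S) :
  ssat N (strans K A) <-> ssat (internal K N) A.
Proof.
rewrite /ssat -sat_trans sat_ren.
suff -> : (fun x => of_void N x.1) =
  (fun xj => sval (of_void (internal K N) xj.1) xj.2) by [].
by apply/funext => -[[]].
Qed.

(** Formulas cannot tell related tuples apart, so [tdom K] and [tpred K] are respected
    componentwise. *)
Lemma internal_iso K (N1 N2 : structure S') (R : N1 -> N2 -> Prop) :
  iso R ->
  iso (fun (x : internal K N1) (y : internal K N2) =>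
    forall j, R (sval x j) (sval y j)).
Proof.
move=> isoR; have [Rl Rr _] := isoR; split=> [[x sx]|[y sy]|p v w vw] /=.
- have [y xy] := choice (fun j => Rl (x j)).
  by exists (exist _ y (iffLR (iso_sat (tdom K) isoR xy) sx)).
- have [x xy] := choice (fun j => Rr (y j)).
  by exists (exist _ x (iffRL (iso_sat (tdom K) isoR xy) sy)).
- by apply: (iso_sat _ isoR) => -[i j]; apply: vw.
Qed.

End Internal.

Lemma internal_idt_iso (S : signature) (N : structure S) :
  iso (fun (x : internal (idt S) N) n => forall j, sval x j = n).
Proof.
split=> [x|n|p v w vw] /=.
- by exists (sval x ord0) => j; rewrite ord1.
- by exists (exist _ (fun _ => n) id).
- by rewrite (_ : (fun i => sval (v i) ord0) = w) //; apply/funext => i.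
Qed.

Lemma flat_inj m k (i i' : 'I_m) (j j' : 'I_k) :
  flat i j = flat i' j' -> i = i' /\ j = j'.
Proof.
move=> /(congr1 val) /= E; have k_gt0 : 0 < k by case: k j {j' E} => [[]|].
split; apply: val_inj => /=.
  have := congr1 (divn^~ k) E.
  by rewrite /= !divnMDl // !divn_small // !addn0.
have := congr1 (modn^~ k) E.
by rewrite /= !modnMDl !modn_small.
Qed.

Lemma flat_surj m k (l : 'I_(m * k)) : exists ij, flat ij.1 ij.2 = l :> 'I_(m * k).
Proof.
have k_gt0 : 0 < k by case: k l => // -[l /=]; rewrite muln0.
have ltl : l %/ k < m by rewrite ltn_divLR.
exists (Ordinal ltl, Ordinal (ltn_pmod l k_gt0)); apply: val_inj => /=.
by rewrite -divn_eq.
Qed.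

(** * Internal models of composed translations *)

Section Composition.
Variables (S S' S'' : signature) (M : translation S' S'') (K : translation S S').
Variable N : structure S''.
Local Notation NMK := (internal K (internal M N)).

Lemma sat_tdom_tcomp (f : 'I_(dim K * dim M) -> N) :
  sat (tdom (tcomp M K)) f <->
  exists x : NMK, forall i j, sval (sval x i) j = f (flat i j).
Proof.
rewrite [tdom _]/= sat_and sat_big_and; split.
  move=> [sM]; rewrite sat_ren => sK.
  have sM' i : sat (tdom M) (fun j => f (flat i j)) by move: (sM i); rewrite sat_ren.
  pose x i : internal M N := exist _ _ (sM' i).
  by exists (exist _ x (iffLR (sat_trans (tdom K) x) sK)).
move=> [x xf]; rewrite sat_ren; split=> [i|].
  rewrite sat_ren (_ : (fun j => _) = sval (sval x i)); first exact: svalP.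
  by apply/funext => j; rewrite xf.
have := iffRL (sat_trans (tdom K) (sval x)) (svalP x).
by congr (sat _ _); apply/funext => -[i j] /=; rewrite xf.
Qed.

Lemma sat_tpred_tcomp p (f : 'I_(arityp p) * 'I_(dim K * dim M) -> N)
    (x : 'I_(arityp p) -> NMK) :
  (forall a i j, sval (sval (x a) i) j = f (a, flat i j)) ->
  sat (tpred (tcomp M K) p) f <-> interp x.
Proof.
move=> xf; rewrite [tpred _ _]/= sat_and sat_big_and.
have E : sat (ren (fun aij => (aij.1.1, flat aij.1.2 aij.2)) (trans M (tpred K p))) f
    <-> sat (tpred K p) (fun ij => sval (x ij.1) ij.2).
  rewrite sat_ren -sat_trans.
  suff -> : (fun x0 => f (x0.1.1, flat x0.1.2 x0.2)) =
    (fun xj => sval (sval (x xj.1.1) xj.1.2) xj.2) by [].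
  by apply/funext => -[[a i] j] /=; rewrite xf.
split=> [[_ /E] //|/E]; split=> // a; rewrite sat_big_and => i.
rewrite sat_ren (_ : (fun j => _) = sval (sval (x a) i)); first exact: svalP.
by apply/funext => j; rewrite xf.
Qed.

(** The two sides differ by flattening tuples of tuples, so composition of internal models is stated
    as an isomorphism. *)
Lemma internal_tcomp_iso :
  iso (fun (y : internal (tcomp M K) N) (x : NMK) =>
    forall i j, sval (sval x i) j = sval y (flat i j)).
Proof.
split=> [y|x|p v w vw].
- by apply/sat_tdom_tcomp; apply: svalP.
- have [g gK] := choice (@flat_surj (dim K) (dim M)).
  pose f l := sval (sval x (g l).1) (g l).2.
  have xf i j : sval (sval x i) j = f (flat i j).
    by rewrite /f; have [-> ->] := flat_inj (gK (flat i j)).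
  have sf : sat (tdom (tcomp M K)) f by apply/sat_tdom_tcomp; exists x.
  by exists (exist _ f sf).
- exact: sat_tpred_tcomp.
Qed.

End Composition.

(* [dom_id] and [pred_id] are the formulas whose provability is
   [int0_eq (tcomp K M) (idt S')]. *)
Definition dom_id (S S' : signature) (K : translation S S')
    (M : translation S' S) (e : dim M * dim K = 1) : form S' 'I_1 :=
  Iff (ren (cast_ord e) (tdom (tcomp K M))) (tdom (idt S')).

Definition pred_id (S S' : signature) (K : translation S S')
    (M : translation S' S) (e : dim M * dim K = 1) (p : predicate S') :
    form S' ('I_(arityp p) * 'I_1) :=
  Imp (\big[And/Top]_(a < arityp p)
         ren (fun j => (a, cast_ord e j)) (tdom (tcomp K M)))
      (Iff (ren (fun aj => (aj.1, cast_ord e aj.2)) (tpred (tcomp K M) p))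
           (tpred (idt S') p)).

Lemma internal_internal_eqP (S S' : signature) (K : translation S S')
    (M : translation S' S) (N : structure S') (e : dim M * dim K = 1) :
  internal_internal_eq K M N <->
  (forall v : 'I_1 -> N, sat (dom_id e) v) /\
  forall p (v : 'I_(arityp p) * 'I_1 -> N), sat (pred_id e p) v.
Proof.
have tdomE (v : 'I_1 -> N) : sat (ren (cast_ord e) (tdom (tcomp K M))) v <->
    exists y : internal M (internal K N), is_elem y (v ord0).
  rewrite sat_ren sat_tdom_tcomp; split=> -[y yv]; exists y => i j.
    by rewrite yv ord1.
  by rewrite yv ord1.
have tdomE' (X : Type) (a : X) (v : X * 'I_1 -> N) :
    sat (ren (fun j => (a, cast_ord e j)) (tdom (tcomp K M))) v <->
    exists y : internal M (internal K N), is_elem y (v (a, ord0)).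
  by rewrite -(tdomE (fun j => v (a, j))) !sat_ren.
split=> [[_ surj eqp]|[sdom spred]].
  split=> [v|p v]; first by apply/sat_iff; split=> [_ []|_]; apply/tdomE; apply: surj.
  rewrite /pred_id sat_imp => /sat_big_and sv; apply/sat_iff.
  have [y yv] := choice (fun a => iffLR (tdomE' _ a v) (sv a)).
  rewrite sat_ren; apply: iff_trans (eqp p y (fun a => v (a, ord0)) yv).
  apply: sat_tpred_tcomp.
  by move=> a i j; rewrite yv ord1.
split=> // [n|p y w yw].
  apply/(tdomE (fun=> n)); have /sat_iff[_] := sdom (fun=> n).
  by apply.
have := spred p (fun aj => w aj.1).
rewrite /pred_id sat_imp sat_iff => sp.
have {sp} := sp (iffRL (sat_big_and _ _)
  (fun a => iffRL (tdomE' _ a _) (ex_intro _ (y a) (yw a)))).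
rewrite sat_ren; apply: iff_trans; apply: iff_sym.
apply: sat_tpred_tcomp => a i j.
exact: yw.
Qed.

(** * Provability read in models *)

Section Validity.
Variable T : theory.

Lemma provesP X (A : form (tsig T) X) :
  proves A <-> forall (N : structure (tsig T)) (v : X -> N), is_model N -> sat A v.
Proof.
split=> [dA N v mN|]; [exact: soundness | exact: completeness].
Qed.

(** Interpretations and elementary equivalence speak of sentences only; closing over finitely many
    variables makes them apply to open formulas. *)
Definition closure (X : finType) (A : form (tsig T) X) : sentence (tsig T) :=
  alls (ren (fun x => inr (enum_rank x) : void + 'I_#|X|) A).

Lemma ssat_closure (X : finType) (A : form (tsig T) X) (N : structure (tsig T)) :
  ssat N (closure A) <-> forall v : X -> N, sat A v.
Proof.
rewrite /ssat sat_alls; split=> sA v; last by rewrite sat_ren.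
have := sA (fun i => v (enum_val i)); rewrite sat_ren.
by congr (sat A _); apply/funext => x; rewrite enum_rankK.
Qed.

End Validity.

(* An internal model need not interpret identity by equality, so it is not a
   model in the sense of [is_model]; hence the detour through sentences. *)
Lemma internal_valid (U V : theory) (M : interpretation V U)
    (N : structure (tsig U)) (X : finType) (A : form (tsig V) X) :
  is_model N -> proves A -> forall v : X -> internal M N, sat A v.
Proof.
move=> mN dA; apply/ssat_closure/ssat_strans.
apply: soundness mN _; apply: itransP; apply/provesP => P v mP.
rewrite (_ : v = of_void P); last by apply/funext; case.
by apply/ssat_closure => w; apply: soundness.
Qed.

(** The condition on dimensions stands apart because a theory without models would not yield it from
    the second conjunct. *)
Lemma int0_eq_idP (S : signature) (V : theory) (K : translation S (tsig V))
    (M : translation (tsig V) S) :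
  dim M * dim K = 1 /\
    (forall N : structure (tsig V), is_model N -> internal_internal_eq K M N) <->
  int0_eq (tcomp K M) (idt (tsig V)).
Proof.
split=> [[e eqN]|[e [/provesP dd dp]]].
  have sN N mN := iffLR (internal_internal_eqP N e) (eqN N mN).
  exists e; split=> [|p]; apply/provesP => N v /sN[sd sp]; first exact: sd.
  exact: sp.
split=> // N mN; apply/(internal_internal_eqP N e); split=> [v|p v].
  exact: dd.
exact: (iffLR (provesP _) (dp p)).
Qed.

Lemma int3_eq_idP (S : signature) (U : theory) (K : translation (tsig U) S)
    (M : translation S (tsig U)) :
  (forall N : structure (tsig U),
     is_model N -> elem_equiv (internal K (internal M N)) N) <->
  int3_eq (tcomp M K) (idt (tsig U)).
Proof.
have E (N : structure (tsig U)) A :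
    ssat N (Iff (strans (tcomp M K) A) (strans (idt (tsig U)) A)) <->
    (ssat (internal K (internal M N)) A <-> ssat N A).
  rewrite /ssat sat_iff -!/(ssat _ _) !ssat_strans.
  rewrite (iso_elem_equiv (internal_tcomp_iso M K N) A).
  by rewrite (iso_elem_equiv (internal_idt_iso N) A).
split=> [eqN A|dA N mN A].
  apply/provesP => N v mN; rewrite (_ : v = of_void N); last by apply/funext; case.
  by apply/E; apply: eqN.
by apply/E; apply: soundness mN (dA A).
Qed.

(** Apply [internal K] to the isomorphism [is_elem] between [internal M (internal K P)] and [P]. *)
Lemma internal_fixed (S S' : signature) (K : translation S S')
    (M : translation S' S) (P : structure S') :
  internal_internal_eq K M P -> internal_internal_eq M K (internal K P).
Proof.
move=> [e surj eqp].
have /andP[/eqP dM /eqP dK] : (dim M == 1) && (dim K == 1) by rewrite -muln_eq1 e.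
have oneM (i j : 'I_(dim M)) : i = j by move: i j; rewrite dM => i j; rewrite !ord1.
have oneK (i j : 'I_(dim K)) : i = j by move: i j; rewrite dK => i j; rewrite !ord1.
have iM : 'I_(dim M) by rewrite dM; exact: ord0.
have iK : 'I_(dim K) by rewrite dK; exact: ord0.
have isoE : iso (fun (y : internal M (internal K P)) n => is_elem y n).
  split=> // y; exists (sval (sval y iM) iK) => i j.
  by rewrite (oneM i iM) (oneK j iK).
have [_ surjK eqK] := internal_iso K isoE.
(* With all dimensions 1, the componentwise relation given by [internal_iso] is again [is_elem];
   points of [internal K P] are equal once their tuples are. *)
have elemE (x : internal K (internal M (internal K P))) (q : internal K P) :
    is_elem x q <-> forall j, is_elem (sval x j) (sval q j).
  split=> [xq j i k|xq i j]; first by rewrite xq (oneK k j).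
  by apply: sval_inj; apply/funext => k; rewrite (oneK k i); apply: xq.
split=> [|q|p v w vw]; first by rewrite mulnC.
  by have [x xq] := surjK q; exists x; apply/elemE.
by apply: eqK => i; apply/elemE.
Qed.

Definition trivial_translation (S S' : signature) : translation S S' :=
  @Translation S S' 1 Top (fun _ => Bot).

(** By completeness both theories prove everything; dimension 1 makes the composites match [idt] by
    computation. *)
Lemma inconsistent_synonymous (U V : theory) :
  (forall N : structure (tsig U), ~ is_model N) ->
  (forall N : structure (tsig V), ~ is_model N) ->
  synonymous U V.
Proof.
move=> noU noV.
have dU X (A : form (tsig U) X) : proves A by apply/provesP => N v /noU.
have dV X (A : form (tsig V) X) : proves A by apply/provesP => N v /noV.
exists (@Interpretation U V (trivial_translation _ _) (fun A _ => dV _ _)).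
exists (@Interpretation V U (trivial_translation _ _) (fun A _ => dU _ _)).
by split; exists erefl; split.
Qed.

Theorem theorem5p1 (U V : theory) (K : interpretation U V)
    (M : interpretation V U) :
  [/\ dim M * dim K = 1 /\
        (forall N : structure (tsig V),
           is_model N -> internal_internal_eq K M N) <->
      int0_eq (tcomp K M) (idt (tsig V)),
      (forall N : structure (tsig U),
         is_model N -> elem_equiv (internal K (internal M N)) N) <->
      int3_eq (tcomp M K) (idt (tsig U))
    & (forall N : structure (tsig V),
         is_model N -> internal_internal_eq K M N) ->
      (forall N : structure (tsig U),
         is_model N -> elem_equiv (internal K (internal M N)) N) ->
      synonymous U V].
Proof.
split; [exact: int0_eq_idP | exact: int3_eq_idP | move=> eqV eqU].
have [[N0 mN0]|noV] := pselect (exists N : structure (tsig V), is_model N); last first.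
  have noV' (N : structure (tsig V)) : ~ is_model N by move=> mN; apply: noV; exists N.
  apply: inconsistent_synonymous => // N mN.
  (* [V] proves [Bot] by completeness, and [M] carries this to [U], so [U] has no model either. *)
  have dBot : @proves V void Bot by apply/provesP => P v /noV'.
  exact: (soundness (of_void N) mN (itransP M dBot)).
have [e _ _] := eqV _ mN0.
have e' : dim K * dim M = 1 by rewrite mulnC.
have eqKM : int0_eq (tcomp K M) (idt (tsig V)) by apply/int0_eq_idP.
exists K, M; split=> //; apply/int0_eq_idP; split=> // N mN.
have [eKM [dd dp]] := eqKM.
(* [eqV] speaks of genuine models only; its formal version [eqKM] is provable in [V] and therefore
   holds in [internal M N]. *)
have fixP : internal_internal_eq K M (internal M N).
  apply/(internal_internal_eqP _ eKM); split=> [v|p v].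
    exact: (internal_valid mN dd).
  exact: (internal_valid mN (dp p)).
have /(internal_internal_eqP _ e')[sd sp] := internal_fixed fixP.
(* [sd] and [sp] hold in [internal K (internal M N)]; their universal closures are sentences, which
   [eqU] transfers to [N]. *)
apply/(internal_internal_eqP _ e'); split=> [|p].
  by apply/ssat_closure/(eqU N mN)/ssat_closure.
by apply/ssat_closure/(eqU N mN)/ssat_closure; apply: sp.
Qed.
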